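(* Let $c>0$ be a constant independent of $d$. Let $d\ge 1$ and let $-1\le \alpha_i<\beta_i\le 1$ for $i=1,\dots,d$ be such that the collection of segments $s_i=[\alpha_i,\beta_i]$, $i=1,\dots,d$, is unisolvent for histopolation in $\mathscr{P}_{d-1}(I)$, $I=[-1,1]$, and $\max_{1\le i\le d}(\beta_i-\alpha_i)\ge c$. Let $V_d\in\mathbb{R}^{d\times d}$ be the histopolation Vandermonde matrix in the monomial basis, $[V_d]_{i,j}=\int_{\alpha_i}^{\beta_i}x^{j-1}\,\mathrm{d}x$. Then $$\kappa_2(V_d)\ \ge\ \frac{c}{\sqrt d}\,2^{d-2}.$$
   Context: $\mathscr{P}_{d-1}(I)$ is the space of real polynomials of degree at most $d-1$ on $I$. A collection of segments $s_1,\dots,s_d$ is unisolvent for histopolation in $\mathscr{P}_{d-1}(I)$ if the only $p\in\mathscr{P}_{d-1}(I)$ with $\int_{s_i}p(x)\,\mathrm{d}x=0$ for all $i=1,\dots,d$ is $p=0$ (equivalently, $V_d$ is invertible). $\kappa_2(A)=\|A\|_2\|A^{-1}\|_2$ is the condition number in the spectral (Euclidean operator) norm. *)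

(* Defs.v *)
From HB Require Import structures.
From mathcomp Require Import all_boot all_order all_algebra.
From mathcomp Require Import all_classical all_reals all_analysis.

Set Implicit Arguments.
Unset Strict Implicit.
Unset Printing Implicit Defensive.

Import Order.TTheory GRing.Theory Num.Theory.
Import numFieldNormedType.Exports.

Local Open Scope classical_set_scope.
Local Open Scope ring_scope.

(* The norm that MathComp-Analysis puts on matrices is the max norm. *)
Definition norm2 (R : realType) (n : nat) (x : 'cV[R]_n) : R :=
  Num.sqrt (\sum_(i < n) x i 0 ^+ 2).

(* In finite dimension this supremum is taken over a nonempty bounded set, so
   [sup] never returns its default value here. *)
Definition opnorm2 (R : realType) (m n : nat) (A : 'M[R]_(m, n)) : R :=
  sup [set norm2 (A *m x) | x in [set x : 'cV[R]_n | norm2 x <= 1]].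

(* Meaningful for invertible [A] only: [invmx A = A] when [A] is singular. *)
Definition kappa2 (R : realType) (n : nat) (A : 'M[R]_n) : R :=
  opnorm2 A * opnorm2 (invmx A).

(* A real polynomial is determined by its values on [-1, 1], so the space of
   polynomial functions of degree at most d - 1 on that interval is identified
   with the polynomials [p] such that [size p <= d]. *)
Definition unisolvent (R : realType) (d : nat) (alpha beta : 'I_d -> R) : Prop :=
  forall p : {poly R}, (size p <= d)%N ->
    (forall i : 'I_d,
       \int[lebesgue_measure]_(x in `[alpha i, beta i]) p.[x] = 0) ->
    p = 0.

(* Column indices start at 0, hence the exponent [j] in place of j - 1. *)
Definition histVandermonde (R : realType) (d : nat) (alpha beta : 'I_d -> R) :
    'M[R]_d :=
  \matrix_(i < d, j < d)
    \int[lebesgue_measure]_(x in `[alpha i, beta i]) x ^+ j.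

(* Main.v *)
Require Import Defs.
From mathcomp Require Import all_boot all_order all_algebra.
From mathcomp Require Import all_classical all_reals all_analysis.
From mathcomp Require Import ring.
Import Order.TTheory GRing.Theory Num.Theory.
Import numFieldNormedType.Exports.
Local Open Scope ring_scope.

(** The product defining the condition number is bounded below by testing each
    factor on one vector. The column [V e_0] lists the lengths of the segments,
    so [opnorm2 V] is at least the largest length, hence at least [c]. For the
    inverse, a polynomial of degree at most [d - 1] is needed whose
    coefficients are large while its integrals over the segments are small.
    The derivative of the Chebyshev polynomial [T_d] does this: its integral
    over a segment is a difference of two values of [T_d], which has modulus at
    most 2 because [T_d] is bounded by 1 on [-1, 1], and its leading
    coefficient is [d * 2 ^ (d - 1)]. If [x] is its coefficient vector, then
    [norm2 x >= 2 ^ (d - 1)] and [norm2 (V x) <= 2 * sqrt d]. Since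
    [x = V^-1 (V x)], this gives [opnorm2 V^-1 >= 2 ^ (d - 2) / sqrt d].

    Integrating [T_d'] exactly, rather than bounding [T_(d-1)] pointwise, treats
    all [d >= 1] uniformly and avoids a loss of a factor 2 in the constant. *)

(** * Euclidean and spectral norms *)

Lemma norm2_ge0 (R : realType) (n : nat) (x : 'cV[R]_n) : 0 <= norm2 x.
Proof. exact: sqrtr_ge0. Qed.

Lemma norm2_0 (R : realType) (n : nat) : norm2 (0 : 'cV[R]_n) = 0.
Proof.
by rewrite /norm2 big1 ?sqrtr0// => i _; rewrite mxE expr0n.
Qed.

Lemma norm2Z (R : realType) (n : nat) (a : R) (x : 'cV[R]_n) :
  norm2 (a *: x) = `|a| * norm2 x.
Proof.
rewrite /norm2; under eq_bigr do rewrite mxE exprMn.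
by rewrite -mulr_sumr sqrtrM ?sqr_ge0// sqrtr_sqr.
Qed.

Lemma ler_norm_norm2 (R : realType) (n : nat) (x : 'cV[R]_n) (i : 'I_n) :
  `|x i 0| <= norm2 x.
Proof.
rewrite -sqrtr_sqr ler_wsqrtr// (bigD1 i)//= lerDl.
by rewrite sumr_ge0// => j _; exact: sqr_ge0.
Qed.

Lemma ler_norm2 (R : realType) (n : nat) (x : 'cV[R]_n) (b : 'I_n -> R) :
  (forall i, `|x i 0| <= b i) -> norm2 x <= Num.sqrt (\sum_(i < n) b i ^+ 2).
Proof.
move=> xb; rewrite ler_wsqrtr// ler_sum// => i _.
by rewrite -real_normK ?num_real// lerXn2r// ?nnegrE// (le_trans _ (xb i)).
Qed.

Lemma norm2_delta (R : realType) (n : nat) (i : 'I_n) :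
  norm2 (delta_mx i 0 : 'cV[R]_n) = 1.
Proof.
rewrite /norm2 (bigD1 i)//= big1 => [|j ji]; last first.
  by rewrite mxE (negbTE ji) expr0n.
by rewrite mxE !eqxx expr1n addr0 sqrtr1.
Qed.

(** The set in the definition of [opnorm2] is bounded: on the unit ball every
    entry of [A *m x] is at most the sum of the moduli of the matching row. *)
Lemma has_ubound_opnorm2 (R : realType) (m n : nat) (A : 'M[R]_(m, n)) :
  has_ubound [set norm2 (A *m x) | x in [set x : 'cV[R]_n | norm2 x <= 1]]%classic.
Proof.
exists (Num.sqrt (\sum_(i < m) (\sum_(j < n) `|A i j|) ^+ 2)) => _ [x /= x1 <-].
apply: ler_norm2 => i; rewrite mxE (le_trans (ler_norm_sum _ _ _))// ler_sum// => j _.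
rewrite normrM -[leRHS]mulr1 ler_wpM2l//.
exact: le_trans (ler_norm_norm2 _ _ x j) x1.
Qed.

Lemma opnorm2_ub (R : realType) (m n : nat) (A : 'M[R]_(m, n)) (x : 'cV[R]_n) :
  norm2 x <= 1 -> norm2 (A *m x) <= opnorm2 A.
Proof. by move=> x1; apply: ub_le_sup; [exact: has_ubound_opnorm2|exists x]. Qed.

Lemma norm2_mulmx_le (R : realType) (m n : nat) (A : 'M[R]_(m, n))
    (x : 'cV[R]_n) :
  norm2 (A *m x) <= opnorm2 A * norm2 x.
Proof.
have [x0|xN0] := eqVneq (norm2 x) 0.
  have -> : x = 0.
    apply/colP => i; rewrite [RHS]mxE; apply/eqP; rewrite -normr_le0 -x0.
    exact: ler_norm_norm2.
  by rewrite mulmx0 !norm2_0 mulr0.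
have x_gt0 : 0 < norm2 x by rewrite lt_def xN0 norm2_ge0.
rewrite -ler_pdivrMr// mulrC.
have -> : (norm2 x)^-1 * norm2 (A *m x) = norm2 (A *m ((norm2 x)^-1 *: x)).
  by rewrite -scalemxAr norm2Z gtr0_norm ?invr_gt0.
by apply: opnorm2_ub; rewrite norm2Z gtr0_norm ?invr_gt0// mulVf.
Qed.

(** * Integrals of polynomials *)

Lemma Rintegral_deriv (R : realType) (p : {poly R}) (a b : R) : a < b ->
  \int[lebesgue_measure]_(x in `[a, b]) (p^`()).[x] = p.[b] - p.[a].
Proof.
move=> ab; rewrite /Rintegral (@continuous_FTC2 _ _ (horner p))//.
- by apply: continuous_subspaceT => x; exact: continuous_horner.
- split=> [x _||]; first exact: derivable_horner.
  + by apply: cvg_at_right_filter; exact: continuous_horner.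
  + by apply: cvg_at_left_filter; exact: continuous_horner.
- by move=> x _; rewrite derivE.
Qed.

Lemma Rintegral_monomial (R : realType) (a b : R) (j : nat) : a < b ->
  \int[lebesgue_measure]_(x in `[a, b]) x ^+ j
    = (b ^+ j.+1 - a ^+ j.+1) / j.+1%:R.
Proof.
move=> ab; have := @Rintegral_deriv _ (j.+1%:R^-1 *: 'X^(j.+1)) _ _ ab.
rewrite !hornerE mulrC [_ * a ^+ _]mulrC -mulrBl => <-.
apply: eq_Rintegral => x _.
rewrite derivZ derivXn/= hornerZ hornerMn hornerXn mulrnAr -mulrnAl.
by rewrite -[X in X * _]mulr_natr mulVf ?pnatr_eq0// mul1r.
Qed.

(** Both sides are computed from the explicit antiderivative
    [\sum_j p_j / (j + 1) X^(j+1)]. *)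
Lemma Rintegral_horner (R : realType) (d : nat) (p : {poly R}) (a b : R) :
  a < b -> (size p <= d)%N ->
  \int[lebesgue_measure]_(x in `[a, b]) p.[x]
    = \sum_(j < d) (\int[lebesgue_measure]_(x in `[a, b]) x ^+ j) * p`_j.
Proof.
move=> ab pd.
pose P : {poly R} := \sum_(j < d) (p`_j / j.+1%:R) *: 'X^(j.+1).
have P'E : P^`() = p.
  rewrite raddf_sum/=; under eq_bigr => j _.
    rewrite derivZ derivXn/= -scalerMnr scalerMnl -[X in X *: _]mulr_natr divfK ?pnatr_eq0//; over.
  rewrite -poly_def; apply/polyP => k; rewrite coef_poly.
  by case: ltnP => // dk; rewrite nth_default// (leq_trans pd).
rewrite -[in LHS]P'E Rintegral_deriv// !horner_sum -sumrB.
apply: eq_bigr => j _; rewrite Rintegral_monomial// !hornerE -mulrBr.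
by rewrite mulrAC [RHS]mulrC -mulrA.
Qed.

(** * The histopolation matrix *)

(** This identity lets both unisolvence and the test polynomial act on the
    matrix. *)
Lemma histVandermonde_mul (R : realType) (d : nat) (alpha beta : 'I_d -> R)
    (p : {poly R}) (i : 'I_d) : alpha i < beta i -> (size p <= d)%N ->
  (histVandermonde alpha beta *m \col_j p`_j) i 0
    = \int[lebesgue_measure]_(x in `[alpha i, beta i]) p.[x].
Proof.
move=> ab pd; rewrite (@Rintegral_horner _ d)// mxE.
by apply: eq_bigr => j _; rewrite !mxE.
Qed.

(** A row vector killed by the transpose holds the coefficients of a polynomial
    whose integrals over all the segments vanish. *)
Lemma histVandermonde_unit (R : realType) (d : nat) (alpha beta : 'I_d -> R) :
  (forall i, alpha i < beta i) -> unisolvent alpha beta ->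
  histVandermonde alpha beta \in unitmx.
Proof.
move=> ab uni; rewrite -unitmx_tr unitmxE unitfE; apply/negP => /det0P[v vN0 vV].
case/eqP: vN0.
(* [\poly] takes coefficients indexed by [nat]; [insub] recovers the ordinal,
   and the default 0 is never reached below [d]. *)
pose p : {poly R} := \poly_(j < d) (if insub j is Some k then v 0 k else 0).
have pE (j : 'I_d) : p`_j = v 0 j by rewrite coef_poly ltn_ord valK.
have pd : (size p <= d)%N by exact: size_poly.
have p0 : p = 0.
  apply: uni => // i; rewrite -histVandermonde_mul//.
  have -> : \col_j p`_j = v^T by apply/colP => j; rewrite !mxE pE.
  by rewrite -[histVandermonde _ _]trmxK -trmx_mul vV !mxE.
by apply/rowP => j; rewrite -pE p0 coef0 mxE.
Qed.

(** * Chebyshev polynomials *)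

Fixpoint chebyshev (R : realType) (n : nat) : {poly R} :=
  if n is n'.+1 then
    if n' is n''.+1 then 2 *: ('X * chebyshev R n') - chebyshev R n'' else 'X
  else 1.

Lemma chebyshev_cos (R : realType) (n : nat) (t : R) :
  (chebyshev R n).[cos t] = cos (n%:R * t).
Proof.
suff : (chebyshev R n).[cos t] = cos (n%:R * t) /\
       (chebyshev R n.+1).[cos t] = cos (n.+1%:R * t) by case.
elim: n => [|n [IH0 IH1]]; first by rewrite /= hornerC hornerX mul0r cos0 mul1r.
split=> //; rewrite [chebyshev R n.+2]/= -/(chebyshev R n.+1).
(* The recurrence is the sum of the addition formulas for
   [(n + 1) t + t] and [(n + 1) t - t]. *)
rewrite hornerD hornerN hornerZ hornerM hornerX IH0 IH1.
have -> : n.+2%:R * t = n.+1%:R * t + t by rewrite -addn1 natrD mulrDl mul1r.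
have -> : n%:R * t = n.+1%:R * t - t by rewrite -addn1 natrD mulrDl mul1r addrK.
by rewrite cosB cosD; ring.
Qed.

(** Every point of [-1, 1] is a cosine, where the value is again a cosine. *)
Lemma chebyshev_bound (R : realType) (n : nat) (x : R) :
  -1 <= x -> x <= 1 -> `|(chebyshev R n).[x]| <= 1.
Proof.
move=> x1 x2; have <- : cos (acos x) = x by rewrite acosK// in_itv/= x1.
by rewrite chebyshev_cos cos_max.
Qed.

Lemma size_chebyshev (R : realType) (n : nat) :
  (size (chebyshev R n) <= n.+1)%N.
Proof.
suff : (size (chebyshev R n) <= n.+1)%N /\ (size (chebyshev R n.+1) <= n.+2)%N
  by case.
elim: n => [|n [IH0 IH1]]; first by rewrite /= size_poly1 size_polyX.
split=> //; rewrite [chebyshev R n.+2]/= -/(chebyshev R n.+1).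
apply: leq_trans (size_polyD _ _) _; rewrite geq_max size_polyN.
apply/andP; split; last exact: leq_trans IH0 (leqW (leqnSn _)).
apply: leq_trans (size_scale_leq _ _) _; apply: leq_trans (size_polyMleq _ _) _.
by rewrite size_polyX.
Qed.

Lemma lead_chebyshev (R : realType) (n : nat) :
  (chebyshev R n.+1)`_n.+1 = 2 ^+ n.
Proof.
elim: n => [|n IH]; first by rewrite /= coefX expr0.
rewrite [chebyshev R n.+2]/= -/(chebyshev R n.+1) coefB coefZ coefXM/= IH.
by rewrite [X in _ - X]nth_default ?subr0 ?exprS// ltnW// ltnS size_chebyshev.
Qed.

(** * The lower bounds on the two norms *)

Lemma opnorm2_histVandermonde_ge (R : realType) (d : nat)
    (alpha beta : 'I_d -> R) (i : 'I_d) : alpha i < beta i ->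
  beta i - alpha i <= opnorm2 (histVandermonde alpha beta).
Proof.
case: d alpha beta i => [|d] alpha beta i ab; first by case: i ab.
apply: le_trans (opnorm2_ub _ _ _ _ (delta_mx ord0 0) _); last by rewrite norm2_delta.
apply: le_trans (ler_norm_norm2 _ _ _ i).
by rewrite -colE !mxE Rintegral_monomial// divr1 !expr1 ler_norm.
Qed.

(** The test vector is the image [V x] of the coefficient vector [x] of the
    derivative of the Chebyshev polynomial of degree [d.+1]: every entry of
    [V x] has modulus at most 2, while the top entry of [x] is
    [d.+1 * 2 ^ d]. *)
Lemma opnorm2_inv_histVandermonde_ge (R : realType) (d : nat)
    (alpha beta : 'I_d.+1 -> R) :
  (forall i, [/\ -1 <= alpha i, alpha i < beta i & beta i <= 1]) ->
  histVandermonde alpha beta \in unitmx ->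
  2 ^+ d <= opnorm2 (invmx (histVandermonde alpha beta))
            * (2 * Num.sqrt d.+1%:R).
Proof.
move=> seg unitV; set V := histVandermonde alpha beta in unitV *.
pose p := (chebyshev R d.+1)^`().
have pd : (size p <= d.+1)%N.
  rewrite (leq_trans (size_poly _ _))//.
  by have := size_chebyshev R d.+1; case: (size _).
pose x : 'cV[R]_d.+1 := \col_j p`_j.
have x_ge : 2 ^+ d <= norm2 x.
  apply: le_trans (ler_norm_norm2 _ _ _ ord_max).
  rewrite mxE coef_deriv lead_chebyshev normrMn ger0_norm ?exprn_ge0//.
  by rewrite [leRHS]mulrS lerDl mulrn_wge0 ?exprn_ge0.
have Vx_le : norm2 (V *m x) <= 2 * Num.sqrt d.+1%:R.
  have -> : 2 * Num.sqrt d.+1%:R = Num.sqrt (\sum_(i < d.+1) (2 : R) ^+ 2).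
    rewrite sumr_const card_ord -[_ ^+ 2 *+ _]mulr_natr sqrtrM ?sqr_ge0//.
    by rewrite sqrtr_sqr ger0_norm.
  apply: ler_norm2 => i; have [a1 ab b1] := seg i.
  rewrite histVandermonde_mul// Rintegral_deriv// (le_trans (ler_normB _ _))//.
  rewrite -[leRHS]/(1 + 1) lerD// chebyshev_bound// ltW//.
    exact: le_lt_trans a1 ab.
  exact: lt_le_trans ab b1.
rewrite (le_trans x_ge)// -[x in leLHS](mulKmx unitV).
rewrite (le_trans (norm2_mulmx_le _ _ _ _ _))// ler_wpM2l//.
rewrite (le_trans (norm2_ge0 _ _ (invmx V *m 0)))// opnorm2_ub//.
by rewrite norm2_0.
Qed.

Theorem theorem2p5 (R : realType) (c : R) (hc : 0 < c)
    (d : nat) (hd : (1 <= d)%N) (alpha beta : 'I_d -> R)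
    (hseg : forall i : 'I_d, [/\ -1 <= alpha i, alpha i < beta i & beta i <= 1])
    (huni : unisolvent alpha beta)
    (hmax : c <= \big[Num.max/0]_(i < d) (beta i - alpha i)) :
  c / Num.sqrt d%:R * 2 ^ (d%:Z - 2) <= kappa2 (histVandermonde alpha beta).
Proof.
have ab i : alpha i < beta i by case: (hseg i).
have unitV := histVandermonde_unit _ _ _ _ ab huni.
have V_ge : c <= opnorm2 (histVandermonde alpha beta).
  have [c0|[i _ ci]] := bigmax_geP _ _ _ _ hmax.
    by have := lt_le_trans hc c0; rewrite ltxx.
  exact: le_trans ci (opnorm2_histVandermonde_ge _ _ _ _ _ (ab i)).
case: d hd alpha beta hseg huni hmax ab unitV V_ge => // d _ alpha beta hseg _ _ _ unitV V_ge.
have sqrt_gt0 : 0 < Num.sqrt d.+1%:R :> R by rewrite sqrtr_gt0 ltr0n.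
have -> : 2 ^ (d.+1%:Z - 2) = 2 ^+ d / 2 :> R.
  have -> : d.+1%:Z - 2 = d%:Z - 1 by rewrite -addn1 PoszD; ring.
  by rewrite expfzDr ?pnatr_eq0.
rewrite /kappa2 -mulrA; apply: ler_pM => //; first exact: ltW.
rewrite mulrA mulrC mulrA -invfM ler_pdivrMl ?mulr_gt0// mulrC.
by rewrite opnorm2_inv_histVandermonde_ge.
Qed.
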